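(* Let $\dot S_n$ be the subgroup of $B_n$ generated by $s_1,\dots,s_{n-1}$, and let $\pi\in\dot S_n$ have generalized standard $OGS$ presentation $$\pi=\tau_{k_1}^{i_{k_1}}\cdot\tau_{k_2}^{i_{k_2}}\cdots\tau_{k_m}^{i_{k_m}}$$ such that $-k_j\le i_{k_j}\le k_j-1$ for every $1\le j\le m$, $\sum_{j=1}^m i_{k_j}=0$, and $0\le\sum_{j=r}^m i_{k_j}\le k_{r-1}$ for every $2\le r\le m$. Consider the standard $OGS$ elementary factorization $\pi=\prod_{v=1}^{z(\pi)}\pi^{(v)}$ of $\pi$ regarded as an element of $S_n$. Then $$z(\pi)=\bigl|\{\,1\le j\le m \;:\; i_{k_j}<0\,\}\bigr|.$$
   Context: $B_n$ is the group of signed permutations, i.e. the bijections $\pi$ of $\{\pm1,\dots,\pm n\}$ with $\pi(-i)=-\pi(i)$. It is a Coxeter group with generators $s_0,\dots,s_{n-1}$, where $s_0$ exchanges $1$ and $-1$, and for $1\le i\le n-1$, $s_i$ exchanges $i$ with $i+1$ and $-i$ with $-(i+1)$. Products are read from left to right: $(\pi_1\cdot\pi_2)(i)=\pi_2(\pi_1(i))$. For $1\le k\le n$, $\tau_k=s_0s_1\cdots s_{k-1}$. Every element of $B_n$ has a unique presentation $\tau_1^{i_1}\cdots\tau_n^{i_n}$ with integers $-k\le i_k<k$, called its generalized standard $OGS$ presentation; omitting trivial factors it is written $\tau_{k_1}^{i_{k_1}}\cdots\tau_{k_m}^{i_{k_m}}$ with $k_1<\dots<k_m$ and all $i_{k_j}\ne0$.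 (The three displayed conditions on the exponents hold automatically for elements of $\dot S_n$.) $\dot S_n$ is identified with the symmetric group $S_n$ by sending $s_i$ to the transposition $(i,i+1)$. In $S_n$, for $2\le k\le n$ let $t_k=s_1s_2\cdots s_{k-1}$; every element of $S_n$ has a unique presentation $t_2^{i_2}\cdots t_n^{i_n}$ with $0\le i_k<k$ (standard $OGS$ canonical form). An element with canonical form $\prod_{j=1}^m t_{k_j}^{i_{k_j}}$, $k_1<\dots<k_m$, $0<i_{k_j}<k_j$, $m\ge1$, is a standard $OGS$ elementary element if $\sum_{j=1}^m i_{k_j}\le k_1$. Standard $OGS$ elementary factorization: for $\pi\in S_n$, $z(\pi)$ is the minimal number $z$ such that $\pi$ can be written as $\pi=\prod_{v=1}^{z}\pi^{(v)}$ where each $\pi^{(v)}$ is a standard $OGS$ elementary element with canonical form $\pi^{(v)}=\prod_{j=1}^{m^{(v)}}t_{h^{(v)}_j}^{\imath^{(v)}_j}$ (all $\imath^{(v)}_j>0$), such that $\sum_{j=1}^{m^{(1)}}\imath^{(1)}_j\le h^{(1)}_1$ and, for $2\le v\le z$, $$h^{(v-1)}_{m^{(v-1)}}\le\sum_{j=1}^{m^{(v)}}\imath^{(v)}_j\le h^{(v)}_1 .$$ Such a presentation with $z=z(\pi)$ is the standard $OGS$ elementary factorization of $\pi$ (the identity has $z=0$, the empty product). *)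

(* Defs.v *)
From mathcomp Require Import all_boot all_order all_algebra all_fingroup.

Set Implicit Arguments.
Unset Strict Implicit.
Unset Printing Implicit Defensive.

Import Order.TTheory GRing.Theory Num.Theory.

Local Open Scope group_scope.

(* The rank is written n.+1, so that it ranges over the integers >= 1.        *)
(* (a, false) encodes the point a + 1 and (a, true) encodes -(a + 1).         *)
Definition signed_point (n : nat) : finType := ('I_n.+1 * bool)%type.

Definition sopp (n : nat) (x : signed_point n) : signed_point n :=
  (x.1, ~~ x.2).

(* The point i, for 1 <= i <= n.+1.                                           *)
Definition spt (n i : nat) : signed_point n := (inord i.-1, false).

(* Products in {perm _} are already read from left to right: see permM.       *)
Definition signed_perms (n : nat) : {set {perm signed_point n}} :=
  [set p : {perm signed_point n} | [forall x, p (sopp x) == sopp (p x)]].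

Lemma signed_permsP n (p : {perm signed_point n}) :
  reflect (forall x, p (sopp x) = sopp (p x)) (p \in signed_perms n).
Proof. by rewrite inE; apply: (iffP forallP) => h x; apply/eqP. Qed.

Lemma signed_perms_group_set n : group_set (signed_perms n).
Proof.
apply/group_setP; split=> [|p q /signed_permsP hp /signed_permsP hq].
  by apply/signed_permsP => x; rewrite !perm1.
by apply/signed_permsP => x; rewrite !permM hp hq.
Qed.

Definition B (n : nat) : {group {perm signed_point n}} :=
  Group (signed_perms_group_set n).

(* Meaningful for 0 <= i <= n.                                                *)
Definition gen (n i : nat) : {perm signed_point n} :=
  if i == 0 then tperm (spt n 1) (sopp (spt n 1))
  else tperm (spt n i) (spt n i.+1) *
       tperm (sopp (spt n i)) (sopp (spt n i.+1)).

Definition dotS (n : nat) : {group {perm signed_point n}} :=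
  <<[set gen n i.+1 | i : 'I_n]>>%G.

Definition tau (n k : nat) : {perm signed_point n} :=
  \prod_(0 <= i < k) gen n i.

Definition zexpg (gT : finGroupType) (x : gT) (z : int) : gT :=
  match z with Posz m => x ^+ m | Negz m => x ^- m.+1 end.

(* A presentation is the list of its pairs (k_j, i_{k_j}), j = 1, ..., m.     *)
Definition gOGS_eval (n : nat) (w : seq (nat * int)) : {perm signed_point n} :=
  \prod_(x <- w) zexpg (tau n x.1) x.2.

Definition gOGS_presentation (n : nat) (p : {perm signed_point n})
    (w : seq (nat * int)) : Prop :=
  [/\ sorted ltn (map fst w),
      forall x, x \in w ->
        [/\ (1 <= x.1 <= n.+1)%N, x.2 != 0%R & (- (x.1)%:Z <= x.2 < (x.1)%:Z)%R]
    & p = gOGS_eval n w].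

(* The transposition (i, i+1), for 1 <= i <= n.                               *)
Definition adj (n i : nat) : 'S_n.+1 := tperm (inord i.-1) (inord i).

Definition t (n k : nat) : 'S_n.+1 := \prod_(1 <= i < k) adj n i.

Definition OGS_eval (n : nat) (w : seq (nat * nat)) : 'S_n.+1 :=
  \prod_(x <- w) t n x.1 ^+ x.2.

Definition OGS_canonical (n : nat) (w : seq (nat * nat)) : bool :=
  sorted ltn (map fst w) &&
  all (fun x => (2 <= x.1 <= n.+1) && (0 < x.2 < x.1)) w.

Definition exp_sum (w : seq (nat * nat)) : nat := \sum_(x <- w) x.2.
Definition first_index (w : seq (nat * nat)) : nat := head 0 (map fst w).
Definition last_index (w : seq (nat * nat)) : nat := last 0 (map fst w).

(* Elementary elements are represented by their (unique) canonical forms.     *)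
Definition OGS_elementary (n : nat) (w : seq (nat * nat)) : bool :=
  [&& w != [::], OGS_canonical n w & exp_sum w <= first_index w].

(* F is the list of the canonical forms of the successive factors; the upper  *)
(* bound on exp_sum of every factor is part of OGS_elementary.                *)
Definition elementary_product (n : nat) (s : 'S_n.+1)
    (F : seq (seq (nat * nat))) : Prop :=
  [/\ all (OGS_elementary n) F,
      sorted (fun u v => last_index u <= exp_sum v) F
    & s = \prod_(w <- F) OGS_eval n w].

(* z(s) = z.                                                                  *)
Definition elementary_number (n : nat) (s : 'S_n.+1) (z : nat) : Prop :=
  (exists2 F, elementary_product s F & size F = z) /\
  (forall F, elementary_product s F -> z <= size F).

(* A permutation of {1, ..., n.+1}, extended to the points -i by oddness.     *)
Definition odd_ext_fun (n : nat) (s : 'S_n.+1) (x : signed_point n) :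
  signed_point n := (s x.1, x.2).

Lemma odd_ext_fun_inj n (s : 'S_n.+1) : injective (odd_ext_fun s).
Proof. by move=> [a b] [c d] [/perm_inj -> ->]. Qed.

Definition odd_ext (n : nat) (s : 'S_n.+1) : {perm signed_point n} :=
  perm (@odd_ext_fun_inj n s).

Lemma odd_extM n : {in [set: 'S_n.+1] &, {morph @odd_ext n : r s / r * s}}.
Proof.
by move=> r s _ _; apply/permP => x; rewrite permM !permE /odd_ext_fun permM.
Qed.

Canonical odd_ext_morphism n := Morphism (@odd_extM n).

Lemma odd_ext_injm n : 'injm (@odd_ext n).
Proof.
apply/injmP => r s _ _ /permP rs; apply/permP => a.
by have := rs (a, false); rewrite !permE => -[].
Qed.

(* Inverse of odd_ext; the identification of dotS with the symmetric group,   *)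
(* by the lemmas dotSE and to_sym_gen.                                        *)
Definition to_sym (n : nat) : {perm signed_point n} -> 'S_n.+1 :=
  invm (@odd_ext_injm n).

Lemma odd_ext_adj n i : 0 < i -> odd_ext (adj n i) = gen n i.
Proof.
have tpE (u v a : 'I_n.+1) (c b : bool) :
    tperm (u, c) (v, c) (a, b) = (if c == b then tperm u v a else a, b).
  have [<-|cb] := eqVneq c b.
    by rewrite (@inj_tperm _ _ (fun x => (x, c))) // => x y [].
  by rewrite tpermD // xpair_eqE (negPf cb) andbF.
case: i => // i _; apply/permP => -[a b].
by rewrite /gen permM permE /odd_ext_fun /adj /spt /sopp /= !tpE; case: b.
Qed.

Lemma gen_adj n : <<[set adj n i.+1 | i : 'I_n]>> = [set: 'S_n.+1].
Proof.
apply/eqP; rewrite -subTset -(gen_tperm (ord0 : 'I_n.+1)) gen_subG.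
apply/subsetP => _ /imsetP[y _ ->].
case: y => y; elim: y => [|y IHy] lty.
  rewrite (_ : Ordinal lty = ord0) ?tperm1 ?group1 //; exact: val_inj.
have lty' : y < n.+1 by exact: ltnW.
have -> : tperm ord0 (Ordinal lty) =
    if y == 0 then adj n 1
    else tperm ord0 (Ordinal lty') ^ adj n y.+1.
  have e0 : (ord0 : 'I_n.+1) = inord 0 by apply: val_inj; rewrite /= inordK.
  have e1 : Ordinal lty = inord y.+1 by apply: val_inj; rewrite /= inordK.
  have e2 : Ordinal lty' = inord y by apply: val_inj; rewrite /= inordK.
  case: eqVneq => [y0|yn0]; first by rewrite e0 e1 /adj y0.
  rewrite tpermJ /adj /= e1 e2 tpermL tpermD //; apply/eqP => /(congr1 val) /=.
    by rewrite inordK // => y0; rewrite y0 in yn0.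
  by rewrite inordK.
have mem (i : 'I_n) : adj n i.+1 \in <<[set adj n i.+1 | i : 'I_n]>>.
  by apply/mem_gen/imsetP; exists i.
have /= h := mem (Ordinal (lty : y < n)).
by have [y0|_] := eqVneq y 0; [rewrite -y0 | exact: groupJ (IHy lty') h].
Qed.

Lemma dotSE n : dotS n = @odd_ext n @* [set: 'S_n.+1] :> {set _}.
Proof.
have := morphim_gen (odd_ext_morphism n)
  (subsetT [set adj n i.+1 | i : 'I_n]).
rewrite gen_adj => ->.
suff -> : @odd_ext n @* [set adj n i.+1 | i : 'I_n] =
          [set gen n i.+1 | i : 'I_n] by [].
rewrite morphimEsub ?subsetT // -imset_comp.
by apply: eq_imset => i /=; rewrite odd_ext_adj.
Qed.

Lemma to_sym_gen n i : 0 < i -> to_sym (gen n i) = adj n i.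
Proof. by move=> i0; rewrite -odd_ext_adj // /to_sym invmE ?inE. Qed.

Lemma dotS_sub_B n : dotS n \subset B n.
Proof.
rewrite dotSE morphimEdom; apply/subsetP => _ /imsetP[s _ ->].
by apply/signed_permsP => x; rewrite !permE.
Qed.

(* Main.v *)
(** Forgetting signs maps [tau_k] to [t_k], so the permutation is the product of
    the [t_{k_j}^{i_j}], with negative exponents allowed.  If [rho] is the sum of
    the exponents of the factors still to be applied, then applying [t_k^i]
    rotates the first [k] points and moves the cut [rho] along with them, so the
    cyclic order of two points and the cut is preserved.  This has two
    consequences.  An elementary element with exponent sum [d] is increasing on
    either side of [d], hence all the descents of an elementary product are among
    the exponent sums of its factors.  On the other hand, [k_r] is a descent
    whenever [i_r < 0].  So an elementary product has at least as many factors
    as there are negative exponents.  This number is attained: write each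
    negative power [t_k^i] as [t_k^rho * t_k^(k - rho')], with [rho] and [rho']
    the exponent sums from and after this factor, and cut the word between
    the two powers; each factor then has exponent sum [k]. *)

Require Import Defs.
From mathcomp Require Import all_boot all_order all_algebra all_fingroup.
From mathcomp Require Import zify.

Import Order.TTheory GRing.Theory Num.Theory.

Set Implicit Arguments.
Unset Strict Implicit.

Local Ltac case_lia :=
  repeat match goal with |- context [if ?b then _ else _] =>
    lazymatch b with
    | context [if _ then _ else _] => fail
    | _ => case: (boolP b) => ?
    end
  end; lia.

(** * Powers of [t n k] as rotations of the first [k] points *)

Lemma zexpg_period (gT : finGroupType) (x : gT) k m i :
  (x ^+ k = 1 -> (m%:Z = i + k%:Z)%R -> zexpg x i = x ^+ m)%g.
Proof.
move=> xk1; case: i => j /= mE.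
  by have -> : m = (j + k)%N by [lia]; rewrite expgD xk1 mulg1.
have kE : k = (m + j.+1)%N by lia.
by apply/eqP; rewrite eq_invg_mul -expgD addnC -kE xk1.
Qed.

(** Points are numbered from 0. The successive transpositions carry 0 up to [k - 1], and each other
    point below [k] is lowered by exactly one of them. *)
Lemma t_val n k (a : 'I_n.+1) : k <= n.+1 ->
  t n k a = (if a < k then (if a == 0 :> nat then k.-1 else a.-1) else a) :> nat.
Proof.
rewrite /t; elim: k => [|[|k] IHk] lek.
- by rewrite big_geq // perm1.
- by rewrite big_geq // perm1; case: (val a).
rewrite big_nat_recr //= permM.
have {}IHk := IHk (ltnW lek).
set b := (X in adj _ _ X); rewrite -/b in IHk.
rewrite /adj /=; case: tpermP => [bk|bk|/eqP bk0 /eqP bk1].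
- by move: IHk; rewrite bk !inordK //=; [case_lia | lia].
- by move: IHk; rewrite bk !inordK //=; case_lia.
move: bk0 bk1 IHk; rewrite -!val_eqE /= !inordK //=; last by lia.
case_lia.
Qed.

Lemma t_expg_val n k i (a : 'I_n.+1) : k <= n.+1 -> i <= k ->
  (t n k ^+ i)%g a =
  (if a < k then (if a < i then a + k - i else a - i) else a) :> nat.
Proof.
move=> lekn; elim: i => [|i IHi] leik.
  by rewrite expg0 perm1; case: ifP => //; lia.
by rewrite expgSr permM t_val // (IHi (ltnW leik)); case_lia.
Qed.

Lemma t_period n k : k <= n.+1 -> (t n k ^+ k = 1)%g.
Proof.
move=> lekn; apply/permP => a; apply: val_inj.
by rewrite perm1 /= t_expg_val //; case_lia.
Qed.

Lemma t_zexpg_val n k i (a : 'I_n.+1) :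
    k <= n.+1 -> (- k%:Z <= i <= k%:Z)%R ->
  (((zexpg (t n k) i a : 'I_n.+1) : nat)%:Z =
  if (a < k)%N then
    if (a%:Z < i)%R then a%:Z - i + k%:Z
    else if (k%:Z <= a%:Z - i)%R then a%:Z - i - k%:Z
    else a%:Z - i
  else a%:Z)%R.
Proof.
move=> lekn; case: i => i ik; first by rewrite /= t_expg_val //; case_lia.
rewrite (@zexpg_period _ _ k (k - i.+1)) ?t_period //; last by lia.
by rewrite t_expg_val //; case_lia.
Qed.

Lemma t_zexpg_fix n k i (a : 'I_n.+1) :
    k <= n.+1 -> (- k%:Z <= i <= k%:Z)%R -> k <= a ->
  zexpg (t n k) i a = a.
Proof.
move=> kn ik ka; apply: val_inj.
by have := t_zexpg_val a kn ik; rewrite /=; case_lia.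
Qed.

(** * Forgetting signs *)

Definition word_perm n (w : seq (nat * int)) : 'S_n.+1 :=
  (\prod_(x <- w) zexpg (t n x.1) x.2)%g.

Lemma word_perm_cons n x w :
  word_perm n (x :: w) = (zexpg (t n x.1) x.2 * word_perm n w)%g.
Proof. by rewrite /word_perm big_cons. Qed.

(** A relation rather than a map, since an arbitrary permutation of the signed points need not
    induce one of the absolute values. *)
Definition unsigned n (f : {perm signed_point n}) (s : 'S_n.+1) :=
  forall x, (f x).1 = s x.1.

Section Unsigned.
Variable n : nat.
Implicit Types (f g : {perm signed_point n}) (s r : 'S_n.+1).
Local Open Scope group_scope.

Lemma unsigned1 : @unsigned n 1 1.
Proof. by move=> x; rewrite !perm1. Qed.

Lemma unsignedM f g s r : unsigned f s -> unsigned g r -> unsigned (f * g) (s * r).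
Proof. by move=> fs gr x; rewrite !permM gr fs. Qed.

Lemma unsignedV f s : unsigned f s -> unsigned f^-1 s^-1.
Proof. by move=> fs x; apply: (@perm_inj _ s); rewrite -fs !permKV. Qed.

Lemma unsignedX f s m : unsigned f s -> unsigned (f ^+ m) (s ^+ m).
Proof.
move=> fs; elim: m => [|m IHm]; first exact: unsigned1.
by rewrite !expgS; apply: unsignedM.
Qed.

Lemma unsigned_zexpg f s i : unsigned f s -> unsigned (zexpg f i) (zexpg s i).
Proof. by case: i => m fs /=; [|apply: unsignedV]; apply: unsignedX. Qed.

Lemma unsigned_tau k : unsigned (tau n k) (t n k).
Proof.
rewrite /tau /t; case: k => [|k]; first by rewrite !big_geq //; exact: unsigned1.
(* The generator [s_0] only changes a sign, so it lies over the identity. *)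
rewrite big_ltn // -[X in unsigned _ X]mul1g; apply: unsignedM.
  by move=> x; rewrite perm1 /gen /=; case: tpermP => [->|->|].
rewrite !big_nat; apply: (big_rec2 (@unsigned n)); first exact: unsigned1.
move=> i s f /andP[i0 _] fs; apply: unsignedM => // x.
by rewrite -odd_ext_adj // permE.
Qed.

Lemma unsigned_gOGS w : unsigned (gOGS_eval n w) (word_perm n w).
Proof.
apply: (big_rec2 (fun f s => @unsigned n f s)) => [|x s f _ fs].
  exact: unsigned1.
by apply: unsignedM => //; apply/unsigned_zexpg/unsigned_tau.
Qed.

Lemma to_sym_unsigned f s : f \in dotS n -> unsigned f s -> to_sym f = s.
Proof.
rewrite dotSE morphimEdom => /imsetP[r _ ->] fs.
rewrite /to_sym invmE ?inE //; apply/permP => a.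
by have := fs (a, false); rewrite permE.
Qed.

End Unsigned.

(** * Cyclic order and descents of admissible words *)

(* [rho] is the sum of the exponents of the word. *)
Fixpoint admissible (N K : nat) (rho : int) (w : seq (nat * int)) : bool :=
  if w is x :: w' then
    [&& K < x.1 <= N, (0 <= rho <= x.1%:Z)%R, (0 <= rho - x.2 <= x.1%:Z)%R
      & admissible N x.1 (rho - x.2)%R w']
  else rho == 0%R.

Lemma admissible_lt N K rho w x : admissible N K rho w -> x \in w -> K < x.1.
Proof.
elim: w K rho => //= y w IHw K rho /and4P[/andP[Ky _] _ _ adm].
by rewrite inE => /predU1P[-> //|] /(IHw _ _ adm); apply: ltn_trans.
Qed.

(* The cyclic order of [y], [x] and the cut just before [rho]. *)
Definition cyc_order (K : nat) (rho : int) (y x : nat) : bool :=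
  [|| (y < x) && (x%:Z < rho)%R,
      [&& (x%:Z < rho)%R, (rho <= y%:Z)%R & y <= K]
    | (rho <= y%:Z)%R && (y < x)].

(* A negative power [t_k^i] can move [y] and the cut past a point [x >= k], hence
   the last condition. *)
Lemma word_perm_lt n K rho w (y x : 'I_n.+1) :
    admissible n.+1 K rho w -> cyc_order K rho y x ->
    all (fun u => (0 <= u.2)%R) w \/ x <= K ->
  word_perm n w y < word_perm n w x.
Proof.
elim: w K rho y x => [|[k i] w IHw] K rho y x /=.
  (* With the cut at 0 the cyclic order is the usual order. *)
  by move=> /eqP-> + _; rewrite /cyc_order /word_perm big_nil !perm1; lia.
case/and4P => /andP[Kk kn] rho1 rho2 adm cyc pos.
rewrite word_perm_cons !permM /=.
have ik : (- k%:Z <= i <= k%:Z)%R by lia.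
have := t_zexpg_val y kn ik; have := t_zexpg_val x kn ik.
move: (zexpg (t n k) i x : 'I__) (zexpg (t n k) i y : 'I__) => x' y' x'E y'E.
apply: (IHw k (rho - i)%R) => //; last first.
  by case: pos => [/andP[_ ->]|xK]; [left | right; move: x'E; case_lia].
have {}pos : (0 <= i)%R \/ x <= K by case: pos => [/andP[]|]; [left|right].
by move: cyc x'E y'E; rewrite /cyc_order; case: pos; case_lia.
Qed.

Lemma word_perm_ge n K rho w (a : 'I_n.+1) :
    admissible n.+1 K rho w -> (forall u, u \in w -> u.1 <= a) ->
  word_perm n w a = a.
Proof.
elim: w K rho => [|[k i] w IHw] K rho /=;
  first by rewrite /word_perm big_nil perm1.
case/and4P => /andP[Kk kn] rho1 rho2 adm lea.
rewrite word_perm_cons permM /=.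
have ka : k <= a := lea _ (mem_head _ _).
rewrite t_zexpg_fix //; last by lia.
by apply: IHw adm _ => u uw; apply: lea; rewrite inE uw orbT.
Qed.

(** Earlier indices are smaller than [x.1 = k], so their powers fix [k - 1] and [k]. The negative
    power [i] wraps [k - 1] round to [- i - 1], below the new cut [rho - i], and leaves [k] at or
    above it; so [k] comes first in the cyclic order. *)
Lemma word_perm_descent n K rho w x :
    admissible n.+1 K rho w -> x \in w -> (x.2 < 0)%R ->
  exists a b : 'I_n.+1,
    [/\ a.+1 = b, b = x.1 :> nat & word_perm n w b < word_perm n w a].
Proof.
elim: w K rho => [|[k i] w IHw] K rho /=; first by [].
case/and4P => /andP[Kk kn] rho1 rho2 adm.
rewrite inE => /predU1P[-> /= i0 | xw x0].
  (* The remaining exponents have positive sum [rho - i], so a larger index follows and [k] is a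
     point. *)
  have kn1 : k < n.+1.
    by move: adm; case: (w) => [|u w1] /=; move: rho1; lia.
  have k1n : k.-1 < n.+1 by lia.
  exists (Ordinal k1n), (Ordinal kn1); split=> //=; first by lia.
  have ik : (- k%:Z <= i <= k%:Z)%R by lia.
  rewrite word_perm_cons !permM /=.
  have := t_zexpg_val (Ordinal k1n) kn ik.
  have := t_zexpg_val (Ordinal kn1) kn ik.
  move: (zexpg _ _ : 'S_n.+1) => s /= sb sa.
  apply: (word_perm_lt adm); last right.
    by move: sa sb; rewrite /cyc_order; case_lia.
  by move: sa; case_lia.
have [a [b [ab bx lt_ba]]] := IHw _ _ adm xw x0.
exists a, b; split=> //; rewrite word_perm_cons !permM /=.
have kx := admissible_lt adm xw.
by rewrite !t_zexpg_fix //; lia.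
Qed.

(** * Descents of elementary products *)

Definition to_word (u : seq (nat * nat)) : seq (nat * int) :=
  [seq (x.1, Posz x.2) | x <- u].

Lemma OGS_evalE n u : OGS_eval n u = word_perm n (to_word u).
Proof. by rewrite /word_perm big_map. Qed.

Lemma exp_sum_cons x u : exp_sum (x :: u) = x.2 + exp_sum u.
Proof. by rewrite /exp_sum big_cons. Qed.

Lemma admissible_to_word N K u :
    path ltn K (map fst u) -> all (fun x => x.1 <= N) u ->
    exp_sum u <= first_index u ->
  admissible N K (exp_sum u) (to_word u).
Proof.
elim: u K => [|x u IHu] K; first by rewrite /exp_sum big_nil.
rewrite exp_sum_cons /first_index /= => /andP[Kx pu] /andP[xN uN] le_x.
rewrite Kx xN /=; apply/and3P; split; [by lia | by lia |].
rewrite (_ : _ - _ = (exp_sum u)%:Z)%R; last by lia.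
apply: IHu => //; case: u pu {uN} le_x => [|y u] /=.
  by rewrite /exp_sum big_nil.
by rewrite /first_index /= => /andP[]; lia.
Qed.

Lemma path_ltn_le_last k s : path ltn k s -> all (leq^~ (last k s)) (k :: s).
Proof.
elim: s k => [|y s IHs] k /=; first by rewrite leqnn.
case/andP=> ky /IHs /= /andP[ylast ->].
by rewrite ylast (leq_trans (ltnW ky) ylast).
Qed.

Section Elementary.
Variables (n : nat) (u : seq (nat * nat)).
Hypothesis elem_u : OGS_elementary n u.

Lemma elementary_admissible :
  admissible n.+1 0 (exp_sum u) (to_word u).
Proof.
case/and3P: elem_u => u0 /andP[sort_u /allP bounds] le_first.
apply: admissible_to_word => //; last first.
  by apply/allP => x /bounds; lia.
case: (u) u0 sort_u bounds => //= x u' _ ->.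
by move/(_ x); rewrite mem_head => /(_ isT) /andP[]; lia.
Qed.

Lemma elementary_exp_sum_le_last : exp_sum u <= last_index u.
Proof.
case/and3P: elem_u => u0 /andP[sort_u _] /leq_trans; apply.
rewrite /first_index /last_index; case: (map fst u) sort_u => //= k s.
by move/path_ltn_le_last/andP=> [].
Qed.

Lemma elementary_fix (a : 'I_n.+1) : last_index u <= a -> OGS_eval n u a = a.
Proof.
move=> lea; rewrite OGS_evalE; apply: (word_perm_ge elementary_admissible) => x.
case/mapP=> y yu -> /=; apply: leq_trans lea.
case/and3P: elem_u => _ /andP[sort_u _] _.
have {yu} : y.1 \in map fst u by apply: map_f.
rewrite /last_index; case: (map fst u) sort_u => //= k s.
by move/path_ltn_le_last/allP; apply.
Qed.

Lemma elementary_below (a : 'I_n.+1) :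
  a < last_index u -> OGS_eval n u a < last_index u.
Proof.
rewrite ltnNge; apply: contraR; rewrite -leqNgt => le_ua.
by rewrite -(perm_inj (elementary_fix le_ua)).
Qed.

Lemma elementary_lt (a b : 'I_n.+1) :
  a < b -> ~~ (a < exp_sum u <= b) -> OGS_eval n u a < OGS_eval n u b.
Proof.
move=> ab sep; rewrite OGS_evalE; apply: (word_perm_lt elementary_admissible).
  by rewrite /cyc_order; lia.
by left; apply/allP => x /mapP[y _ ->].
Qed.

End Elementary.

(** The condition on neighbours propagates because the exponent sum of an elementary factor is at
    most its last index. *)
Lemma chain_exp_sum_ge n u F :
    path (fun u v => last_index u <= exp_sum v) u F ->
    all (OGS_elementary n) F ->
  all (fun v => last_index u <= exp_sum v) F.
Proof.
elim: F u => //= v F IHF u /andP[uv pF] /andP[ev eF]; rewrite uv /=.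
apply: sub_all (IHF _ pF eF) => w; apply: leq_trans.
exact: leq_trans uv (elementary_exp_sum_le_last ev).
Qed.

(** The first factor [u] preserves the order of the two points. It permutes the points below
    [last_index u] and fixes the others, so no point crosses a later exponent sum, these being at
    least [last_index u]; the induction continues with the images. *)
Lemma elementary_product_lt n (s : 'S_n.+1) F (a b : 'I_n.+1) :
    elementary_product s F -> a < b ->
    {in F, forall u, ~~ (a < exp_sum u <= b)} ->
  s a < s b.
Proof.
case=> + + -> {s}; elim: F a b => [|u F IHF] a b /=.
  by rewrite big_nil !perm1.
case/andP=> eu eF chainF ab sep; rewrite big_cons !permM.
have leF := allP (chain_exp_sum_ge chainF eF).
have ltu := elementary_lt eu ab (sep _ (mem_head _ _)).
apply: IHF => //; first exact: path_sorted chainF.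
move=> v vF; have lev := leF _ vF.
have sepv : ~~ (a < exp_sum v <= b) by apply: sep; rewrite inE vF orbT.
have [lea|lta] := leqP (last_index u) a.
  by rewrite !(elementary_fix eu) //; lia.
have ltua := elementary_below eu lta.
have [leb|ltb] := leqP (last_index u) b.
  by rewrite (elementary_fix eu leb); lia.
by have := elementary_below eu ltb; lia.
Qed.

(** * Construction of a factorization *)

Definition add_power (k e : nat) (u : seq (nat * nat)) :=
  if e == 0 then u else (k, e) :: u.

Lemma OGS_eval_add_power n k e u :
  OGS_eval n (add_power k e u) = (t n k ^+ e * OGS_eval n u)%g.
Proof.
rewrite /add_power; case: eqP => [->|_]; first by rewrite expg0 mul1g.
by rewrite /OGS_eval big_cons.
Qed.

Lemma exp_sum_add_power k e u : exp_sum (add_power k e u) = e + exp_sum u.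
Proof. by rewrite /add_power; case: eqP => [->|_] //; rewrite exp_sum_cons. Qed.

Lemma OGS_canonical_add_power n K k e u :
    K < k <= n.+1 -> e < k ->
    path ltn k (map fst u) ->
    all (fun x => (2 <= x.1 <= n.+1) && (0 < x.2 < x.1)) u ->
  path ltn K (map fst (add_power k e u)) &&
  all (fun x => (2 <= x.1 <= n.+1) && (0 < x.2 < x.1)) (add_power k e u).
Proof.
move=> Kk ek pu bu; rewrite /add_power; case: eqP => [_|e0] /=.
  rewrite bu andbT; case: (map fst u) pu => //= y s /andP[ky ->].
  by rewrite andbT; lia.
by rewrite pu bu; lia.
Qed.

Lemma last_index_add_power k e u :
  last_index (add_power k e u) <= maxn k (last_index u).
Proof.
rewrite /add_power /last_index; case: eqP => _ /=; first by rewrite leq_maxr.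
by case: (map fst u) => [|y s]; rewrite /= ?leq_maxl ?leq_maxr.
Qed.

(* [u] is the part of the first factor that has been read so far; it is empty
   when the word is complete, as its exponent sum is [rho]. *)
Lemma admissible_factorization n K (rho : nat) w :
    admissible n.+1 K rho w -> rho <= K ->
  exists u F,
    [/\ path ltn K (map fst u) &&
          all (fun x => (2 <= x.1 <= n.+1) && (0 < x.2 < x.1)) u,
        exp_sum u = rho,
        all (OGS_elementary n) F /\ all (fun v => K <= exp_sum v) F,
        path (fun u v => last_index u <= exp_sum v) u F
      & word_perm n w = (OGS_eval n u * \prod_(v <- F) OGS_eval n v)%g /\
        size F = count (fun x : nat * int => (x.2 < 0)%R) w].
Proof.
elim: w K rho => [|[k i] w IHw] K rho /=.
  move=> /eqP[->] _; exists [::], [::]; split=> //.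
    by rewrite /exp_sum big_nil.
  by rewrite /word_perm /OGS_eval !big_nil mulg1.
case/and4P => Kk rho1 rho2 adm rhoK.
have [rho' rho'E] : exists rho' : nat, (rho'%:Z = rho%:Z - i)%R.
  by exists (absz (Posz rho - i)%R); lia.
rewrite -rho'E in adm rho2.
have [u [F [/andP[pu bu] sum_u [eF leF] chain [prodE sizeE]]]] :=
  IHw _ _ adm ltac:(lia).
have lastF v : v \in F -> k <= exp_sum v by apply: (allP leF).
have chainF u' : last_index u' <= maxn k (last_index u) ->
    path (fun u v => last_index u <= exp_sum v) u' F.
  case: (F) chain lastF => //= v F' /andP[uv ->] lastF le_u'; rewrite andbT.
  by have := lastF v (mem_head _ _); lia.
have leKF : all (fun v => K <= exp_sum v) F by apply: sub_all leF => v; lia.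
rewrite word_perm_cons prodE /=.
have tk1 : (t n k ^+ k = 1)%g by apply: t_period; lia.
have [i_ge0|i_lt0] /= := leP 0%R i.
  exists (add_power k `|i|%N u), F; split=> //.
  - by apply: OGS_canonical_add_power => //; lia.
  - by rewrite exp_sum_add_power sum_u; lia.
  - exact: chainF (last_index_add_power _ _ _).
  rewrite OGS_eval_add_power -mulgA sizeE; split=> //.
  by case: i i_ge0 {rho1 rho'E}.
(* The power [k - rho'] completes [u], of sum [rho'], to a factor of sum [k]; the power [rho] opens
   the preceding factor. *)
have sum_v : exp_sum (add_power k (k - rho') u) = k.
  by rewrite exp_sum_add_power sum_u; lia.
have can_v : path ltn K (map fst (add_power k (k - rho') u)) &&
    all (fun x => (2 <= x.1 <= n.+1) && (0 < x.2 < x.1))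
        (add_power k (k - rho') u).
  by apply: OGS_canonical_add_power => //; lia.
exists (add_power k rho [::]), (add_power k (k - rho') u :: F).
split=> /=.
- by apply: OGS_canonical_add_power => //; lia.
- by rewrite exp_sum_add_power /exp_sum big_nil addn0.
- rewrite eF leKF sum_v !andbT; split; last by lia.
  case/andP: can_v => pv bv; rewrite /OGS_elementary /OGS_canonical bv.
  rewrite (path_sorted pv) sum_v /=.
  have v0 : add_power k (k - rho') u != [::].
    by apply/eqP => v0; move: sum_v; rewrite v0 /exp_sum big_nil; lia.
  (* The first index is [k], or a larger one when [rho' = k] and no power is added. *)
  rewrite v0; move: v0; rewrite /add_power /first_index; case: ifP => //= _.
  by case: (u) pu => //= x u' /andP[]; lia.
- by rewrite sum_v chainF ?last_index_add_power // andbT.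
split; last by rewrite sizeE.
rewrite big_cons !OGS_eval_add_power /OGS_eval big_nil mulg1 !mulgA.
congr (_ * _ * _)%g.
(* As [rho' = rho - i], the exponents [rho] and [k - rho'] add up to [i + k]. *)
rewrite -expgD; apply: (zexpg_period tk1); lia.
Qed.

(** * The number of factors *)

(** Each tail sum is bounded by the index preceding the tail, with [K] in this role for the whole
    word; as indices increase, it is also bounded by the first index of the tail. *)
Lemma tails_admissible N K (w : seq (nat * int)) :
    path ltn K (map fst w) -> all (fun x => x.1 <= N) w ->
    (0 <= \sum_(x <- w) x.2 <= K%:Z)%R ->
    (forall r : nat, 0 < r < size w ->
       (0 <= \sum_(x <- drop r w) x.2 <= ((nth (0%N, 0%R) w r.-1).1)%:Z)%R) ->
  admissible N K (\sum_(x <- w) x.2)%R w.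
Proof.
elim: w K => [|x w IHw] K /=; first by rewrite big_nil.
case/andP=> Kx pw /andP[xN wN]; rewrite big_cons => sum_w tails.
have sumE : (x.2 + \sum_(y <- w) y.2 - x.2 = \sum_(y <- w) y.2)%R.
  by rewrite addrC addKr.
have tail1 : (0 <= \sum_(y <- w) y.2 <= x.1%:Z)%R.
  case: w {IHw pw wN sum_w sumE} tails => [|y w] tails; first by rewrite big_nil.
  by have := tails 1%N isT; rewrite drop1.
rewrite Kx xN sumE tail1 /=; apply/andP; split; first by lia.
apply: IHw => // r /andP[r0 rw].
by have := tails r.+1; rewrite /= ltnS rw => /(_ isT); case: r r0 {rw}.
Qed.

Theorem theorem3p0p10 (n : nat) (p : {perm signed_point n})
    (w : seq (nat * int))
    (p_dotS : p \in dotS n)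
    (p_w : gOGS_presentation p w)
    (sum_w : (\sum_(x <- w) x.2 = 0)%R)
    (tails_w : forall r : nat, 0 < r < size w ->
       (0 <= \sum_(x <- drop r w) x.2 <= ((nth (0%N, 0%R) w r.-1).1)%:Z)%R) :
  elementary_number (to_sym p) (count (fun x : nat * int => (x.2 < 0)%R) w).
Proof.
case: p_w => sort_w bounds pE.
have bound_w x : x \in w -> 0 < x.1 <= n.+1 by move/bounds => [].
have path_w : path ltn 0 (map fst w).
  case: w sort_w bound_w {bounds pE sum_w tails_w} => //= x w -> bound_w.
  by case/andP: (bound_w _ (mem_head _ _)) => ->.
have adm : admissible n.+1 0 0 w.
  rewrite -[X in admissible _ _ X _]sum_w; apply: tails_admissible => //.
    by apply/allP => x /bound_w /andP[].
  by rewrite sum_w.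
have -> : to_sym p = word_perm n w.
  by apply: to_sym_unsigned => //; rewrite pE; apply: unsigned_gOGS.
split.
  have [u [F [/andP[_ bu] sum_u [eF _] chain [-> sizeE]]]] :=
    admissible_factorization adm (leqnn 0).
  exists F => //; split=> //; first exact: path_sorted chain.
  have -> : u = [::].
    case: u bu sum_u {chain} => // x u /= /andP[/andP[_ x2] _].
    by rewrite exp_sum_cons; lia.
  by rewrite /OGS_eval big_nil mul1g.
move=> F prodF; rewrite -size_filter -(size_map fst) -(size_map exp_sum F).
apply: uniq_leq_size.
  have: subseq (map fst [seq x <- w | (x.2 < 0)%R]) (map fst w).
    by apply: map_subseq; apply: filter_subseq.
  by move/subseq_uniq; apply; apply: sorted_uniq sort_w;
    [apply: ltn_trans | apply: ltnn].
move=> _ /mapP[x + ->]; rewrite mem_filter => /andP[x0 xw].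
have [a [b [ab bx]]] := word_perm_descent adm xw x0.
(* As [b = a + 1 = x.1], the only exponent sum that could separate [a] from [b] is [x.1] itself. *)
apply: contraLR => notF; rewrite -leqNgt; apply: ltnW.
apply: (elementary_product_lt prodF) => [|u uF]; first by lia.
by apply: contra notF => sep; apply/mapP; exists u; rewrite -?bx; lia.
Qed.
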